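(* Let $H$ be a (not necessarily bounded) self-adjoint operator on a Hilbert space $\mathcal{B}$. If $f\in C_0(\mathbf{R})$, then $$\overline{f(\sigma(H))}\subseteq\sigma(f(H)).$$
   Context: $C_0(\mathbf{R})$ is the algebra of continuous complex-valued functions on $\mathbf{R}$ vanishing at infinity, with supremum norm $\|\cdot\|_\infty$, and $\mathcal{L}(\mathcal{B})$ is the algebra of bounded operators on $\mathcal{B}$. For $f\in C_0(\mathbf{R})$, $f(H)$ denotes the image of $f$ under the functional calculus $C_0(\mathbf{R})\to\mathcal{L}(\mathcal{B})$, $f\mapsto f(H)$, which is the unique map such that: (1) $f\mapsto f(H)$ is an algebra homomorphism; (2) $\overline{f}(H)=f(H)^*$; (3) $\|f(H)\|\le\|f\|_\infty$; (4) if $z\notin\mathbf{R}$ and $g_z(x):=(z-x)^{-1}$ for $x\in\mathbf{R}$, then $g_z(H)=(z-H)^{-1}$. Also $f(\sigma(H)):=\{f(x):x\in\sigma(H)\}$. *)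

(* Defs.v *)
From HB Require Import structures.
From mathcomp Require Import all_boot all_order all_algebra.
From mathcomp Require Import complex.
From mathcomp Require Import all_classical all_reals all_analysis.

Set Implicit Arguments.
Unset Strict Implicit.
Unset Printing Implicit Defensive.

Import Order.TTheory GRing.Theory Num.Theory.
Import numFieldNormedType.Exports.

Local Open Scope classical_set_scope.
Local Open Scope ring_scope.
Local Open Scope complex_scope.

(* The complex numbers are R[i]; their topology is found on the copy R[i]^o.
   The norm of a complex normed space takes its values in R[i] (it is a
   nonnegative real there), whence the real parts in sup_norm and op_norm. *)

Section C0.
Variable R : realType.

Definition C0 : set (R -> R[i]) := [set f |
  [/\ continuous (f : R -> R[i]^o),
      (f x : R[i]^o) @[x --> +oo] --> (0 : R[i]^o)
    & (f x : R[i]^o) @[x --> -oo] --> (0 : R[i]^o)]].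

Definition sup_norm (f : R -> R[i]) : R :=
  sup [set complex.Re `|f x| | x in [set: R]].

Definition resolvent_fun (z : R[i]) : R -> R[i] := fun x => (z - x%:C)^-1.

End C0.

Section Operators.
Variables (R : realType) (B : completeNormedModType R[i]).

(* Values of op_fun outside the domain carry no meaning. *)
Record operator := Operator {
  dom : set B;
  op_fun :> B -> B;
  dom0 : dom 0;
  domP : forall (a : R[i]) x y, dom x -> dom y -> dom (a *: x + y);
  op_linear : forall (a : R[i]) x y, dom x -> dom y ->
    op_fun (a *: x + y) = a *: op_fun x + op_fun y
}.

Record bounded_op := BoundedOp {
  bop_fun :> {linear B -> B};
  bop_bounded : bounded_near bop_fun (nbhs (0 : B))
}.

Definition op_norm (T : bounded_op) : R :=
  sup [set complex.Re `|T x| | x in [set x : B | `|x| <= 1]].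

Definition op_of_bounded (T : bounded_op) : operator :=
  @Operator setT T I (fun _ _ _ _ _ => I) (fun a x y _ _ => linearP T a x y).

Definition op_graph (H : operator) : set (B * B) :=
  [set p | dom H p.1 /\ p.2 = H p.1].

(* S = (z - H)^-1, the inverse of the map z - H from dom H to B *)
Definition is_resolvent (H : operator) (z : R[i]) (S : bounded_op) : Prop :=
  (forall y, dom H (S y) /\ z *: S y - H (S y) = y) /\
  (forall x, dom H x -> S (z *: x - H x) = x).

Definition spectrum (H : operator) : set R[i]^o :=
  [set z | ~ exists S : bounded_op, is_resolvent H z S].

(* Forms are linear in the first argument and conjugate linear in the second. *)
Variable ip : {dot B for Num.conj}.

Definition induces_norm : Prop := forall x : B, `|x| ^+ 2 = ip x x.

Definition adjoint_graph (H : operator) : set (B * B) :=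
  [set p | forall x, dom H x -> ip (H x) p.1 = ip x p.2].

(* S = H^*, for H densely defined *)
Definition is_adjoint (H S : operator) : Prop :=
  op_graph S = adjoint_graph H.

Definition self_adjoint (H : operator) : Prop :=
  dense (dom H) /\ is_adjoint H H.

(* Only the values of phi on C0 matter; two bounded operators are identified
   when they agree pointwise. *)
Record functional_calculus (H : operator) (phi : (R -> R[i]) -> bounded_op) :
    Prop := FunctionalCalculus {
  fcalcD : forall f g, C0 f -> C0 g ->
    forall v, phi (fun x => f x + g x) v = phi f v + phi g v;
  fcalcZ : forall (a : R[i]) f, C0 f ->
    forall v, phi (fun x => a * f x) v = a *: phi f v;
  fcalcM : forall f g, C0 f -> C0 g ->
    forall v, phi (fun x => f x * g x) v = phi f (phi g v);
  fcalc_conj : forall f, C0 f ->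
    is_adjoint (op_of_bounded (phi f))
               (op_of_bounded (phi (fun x => Num.conj (f x))));
  fcalc_norm : forall f, C0 f -> op_norm (phi f) <= sup_norm f;
  fcalc_resolvent : forall z : R[i], complex.Im z != 0 ->
    is_resolvent H z (phi (resolvent_fun z))
}.

End Operators.

(* Main.v *)
Require Import Defs.
From HB Require Import structures.
From mathcomp Require Import all_boot all_order all_algebra.
From mathcomp Require Import complex.
From mathcomp Require Import all_classical all_reals all_analysis.
From mathcomp Require Import ring lra.

Set Implicit Arguments.
Unset Strict Implicit.

Import Order.TTheory GRing.Theory Num.Theory.
Import numFieldNormedType.Exports.
Local Open Scope classical_set_scope.
Local Open Scope ring_scope.
Local Open Scope complex_scope.

(** Let [w] lie outside the spectrum of [f(H)], and let [S] be the inverse of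
    [w - f(H)].  There is a radius, depending only on a bound for [S], such
    that no point [l] of the spectrum of [H] has [f l] within that radius of
    [w]; hence [w] is not in the closure.

    The heuristic is that [w - f(H)] is small on the spectral subspace of [H]
    near [l], which an invertible operator allows only if that subspace is
    zero, and then [l] is in the resolvent set.  Continuous cutoffs replace the
    spectral projection.  Suppose that [f] is close to [w] on the interval of
    radius [2 * d] about [l].  Let [bump] be a cutoff supported within distance
    [d] of [l], and let [plateau] be a cutoff that is [1] where [bump] is
    nonzero and vanishes beyond distance [2 * d].  For [u] in the range of
    [bump(H)],
      [u = S (w - f(H)) u = S ((w - f) * plateau)(H) u],
    and [(w - f) * plateau] has a small sup norm, so [|u| <= |u| / 2] and
    [u = 0]: thus [bump(H) = 0] ([fcalc_bump0]).

    The cutoff is chosen so that [1 - bump x = (l - x) * quot x] with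
    [quot] in [C0].  Once [bump(H) = 0], this says formally that
    [(l - H) quot(H) = 1]; the unbounded factor [l - x] is handled by comparing
    [quot] with the resolvent function [(z - x)^-1] at a single nonreal [z],
    and [quot(H)] turns out to be a resolvent of [H] at [l]
    ([fcalc_quot_resolvent]). *)

(** * Continuous functions vanishing at infinity *)

Section ComplexC0.
Variable R : realType.
Implicit Types (h : R -> R[i]) (u : R -> R) (l d c : R).

Lemma normc_real (x : R) : `|x%:C| = `|x|%:C.
Proof. by rewrite normc_def /= expr0n addr0 sqrtr_sqr. Qed.

Lemma norm_RRe (V : normedZmodType R[i]) (v : V) :
  (complex.Re `|v|)%:C = `|v|.
Proof. by apply/RRe_real/normr_real. Qed.

Lemma complex_gt0P (e : R[i]) : 0 < e -> exists2 r : R, 0 < r & e = r%:C.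
Proof.
by case: e => a b; rewrite ltcE /= => /andP[/eqP -> a0]; exists a.
Qed.

Lemma continuous_real_complex u :
  continuous u -> continuous ((fun x => (u x)%:C) : R -> R[i]^o).
Proof.
move=> uc x; apply/cvgrPdist_lt => e /complex_gt0P[r r0 ->].
have /cvgrPdist_lt /(_ r r0) := uc x.
by apply: filterS => y; rewrite -rmorphB normc_real ltcR.
Qed.

(** The bound is required only away from [l], so that the same criterion serves
    for functions of order [1 / x] (with [c] the constant) and for compactly
    supported ones (with [c = 0] and [d] the radius of the support). *)
Lemma decay_cvg0 h l c d (F : set_system R) : Filter F ->
  (forall A, \forall x \near F, A < `|x - l|) ->
  (forall x, d <= `|x - l| -> `|h x| * `|x - l|%:C <= c%:C) ->
  (h x : R[i]^o) @[x --> F] --> (0 : R[i]^o).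
Proof.
move=> FF Foo hd; apply/cvgr0Pnorm_lt => e /complex_gt0P[r r0 ->].
near=> x.
have xd : d <= `|x - l| by apply: ltW; near: x; exact: Foo.
have x0 : 0 < `|x - l| by near: x; exact: Foo.
have xc : c / r < `|x - l| by near: x; exact: Foo.
have := hd _ xd; rewrite -[X in X * _]norm_RRe -[X in X < _]norm_RRe.
rewrite -rmorphM lecR ltcR => hx.
have : c < `|x - l| * r by rewrite -ltr_pdivrMr.
by move=> /(le_lt_trans hx); rewrite mulrC ltr_pM2l.
Unshelve. all: by end_near. Qed.

Lemma C0_decay h l c d :
  continuous (h : R -> R[i]^o) ->
  (forall x, d <= `|x - l| -> `|h x| * `|x - l|%:C <= c%:C) ->
  C0 h.
Proof.
move=> hc hd; split => //; apply: decay_cvg0 hd => A; near=> x.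
- have : l + `|A| < x by near: x; apply: nbhs_pinfty_gt; rewrite num_real.
  by have := ler_norm A; have := ler_norm (x - l); lra.
- have : x < l - `|A| by near: x; apply: nbhs_ninfty_lt; rewrite num_real.
  by have := ler_norm A; have := ler_norm (l - x); rewrite (distrC l); lra.
Unshelve. all: by end_near. Qed.

Lemma C0D h1 h2 : C0 h1 -> C0 h2 -> C0 (fun x => h1 x + h2 x).
Proof.
move=> [c1 p1 n1] [c2 p2 n2]; split.
- by move=> x; apply: (@cvgD _ R[i]^o); [exact: c1 | exact: c2].
- by rewrite -[X in _ --> X]addr0; apply: (@cvgD _ R[i]^o).
- by rewrite -[X in _ --> X]addr0; apply: (@cvgD _ R[i]^o).
Qed.

Lemma C0M h1 h2 : C0 h1 -> C0 h2 -> C0 (fun x => h1 x * h2 x).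
Proof.
move=> [c1 p1 n1] [c2 p2 n2]; split.
- by move=> x; apply: (@cvgM R[i]); [exact: c1 | exact: c2].
- by rewrite -[X in _ --> X](mulr0 (0 : R[i])); apply: (@cvgM R[i]).
- by rewrite -[X in _ --> X](mulr0 (0 : R[i])); apply: (@cvgM R[i]).
Qed.

Lemma C0Z (a : R[i]) h : C0 h -> C0 (fun x => a * h x).
Proof.
have aM (F : set_system R) (k k' : R[i]^o) : Filter F -> a *: k = k' ->
    (h x : R[i]^o) @[x --> F] --> k -> (a * h x : R[i]^o) @[x --> F] --> k'.
  by move=> FF <-; exact: cvgZl_tmp.
by move=> [ch ph nh]; split=> [x||];
  [exact: aM (ch x) | exact: aM (mulr0 a) ph | exact: aM (mulr0 a) nh].
Qed.

Lemma sub_real_neq0 (z : R[i]) (x : R) : complex.Im z != 0 -> z - x%:C != 0.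
Proof.
by case: z => a b /= b0; rewrite eq_complex /= oppr0 addr0 (negbTE b0) andbF.
Qed.

Lemma C0_resolvent (z : R[i]) : complex.Im z != 0 -> C0 (resolvent_fun z).
Proof.
move=> z0; apply: (@C0_decay _ (complex.Re z) 1 0) => [x | x _].
  have cz : (z - y%:C : R[i]^o) @[y --> x] --> (z - x%:C : R[i]^o).
    have cx : (y%:C : R[i]^o) @[y --> x] --> (x%:C : R[i]^o).
      by apply: (@continuous_real_complex id) => y; exact: cvg_id.
    exact: cvgB (cvg_cst (z : R[i]^o)) cx.
  exact: (cvgV (sub_real_neq0 x z0) cz).
have zx := sub_real_neq0 x z0.
rewrite /resolvent_fun normfV mulrC ler_pdivrMr ?normr_gt0// mul1r distrC.
by have := normc_ge_Re (z - x%:C); case: z {z0 zx} => a b.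
Qed.

Lemma sup_norm_le h c : (forall x, `|h x| <= c%:C) -> sup_norm h <= c.
Proof.
move=> hc; apply: ge_sup; first by exists (complex.Re `|h 0|), 0.
by move=> _ [x _ <-]; rewrite -lecR norm_RRe.
Qed.

(** * Cutoff functions around a point *)

(** The function [1 / (l - x)] beyond distance [d] of [l], continued by the
    linear function [(l - x) / d ^+ 2] across the singularity. *)
Definition quot l d (x : R) : R := (l - x) / Num.max (d ^+ 2) ((l - x) ^+ 2).

(** For [d > 0] this is [max 0 (1 - ((l - x) / d) ^+ 2)]; the double zero of
    [1 - bump] at [l] is what makes [(1 - bump x) / (l - x)] continuous. *)
Definition bump l d (x : R) : R := 1 - (l - x) * quot l d x.

Definition plateau l d (x : R) : R :=
  Num.min 1 (Num.max 0 (2 - (l - x) ^+ 2 / d ^+ 2)).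

(** The identity [(l - x) * quot x = 1 - bump x] divided by [z - x] after
    writing [l - x = (l - z) + (z - x)]: the right-hand side is built
    from [C0] functions only, so the functional calculus applies to it. *)
Lemma quot_resolvent (z : R[i]) l d x : complex.Im z != 0 ->
  (quot l d x)%:C = resolvent_fun z x - resolvent_fun z x * (bump l d x)%:C -
    (l%:C - z) * (resolvent_fun z x * (quot l d x)%:C).
Proof.
move=> z0; have := sub_real_neq0 x z0; rewrite /bump /resolvent_fun.
move: (quot l d x) => q zx.
by rewrite !(rmorphB, rmorphM, rmorph1) /=; field.
Qed.

Section Cutoffs.
Variables l d : R.
Hypothesis d0 : 0 < d.

Let max_gt0 x : 0 < Num.max (d ^+ 2) ((l - x) ^+ 2).
Proof. by rewrite lt_max exprn_gt0. Qed.

Let cvg_lB (x : R) : l - y @[y --> x] --> l - x.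
Proof. by apply: cvgB; [exact: cvg_cst | exact: cvg_id]. Qed.

Let cvg_lB2 (x : R) : (l - y) ^+ 2 @[y --> x] --> (l - x) ^+ 2.
Proof. exact: cvgM (@cvg_lB x) (@cvg_lB x). Qed.

Lemma continuous_quot : continuous (quot l d).
Proof.
move=> x; have max_neq0 : Num.max (d ^+ 2) ((l - x) ^+ 2) != 0.
  by rewrite gt_eqF.
have cmax : Num.max (d ^+ 2) ((l - y) ^+ 2) @[y --> x]
    --> Num.max (d ^+ 2) ((l - x) ^+ 2).
  exact: continuous_max (cvg_cst _) (@cvg_lB2 x).
exact: cvgM (@cvg_lB x) (cvgV max_neq0 cmax).
Qed.

Lemma continuous_bump : continuous (bump l d).
Proof.
by move=> x; exact: cvgB (cvg_cst _) (cvgM (@cvg_lB x) (@continuous_quot x)).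
Qed.

Lemma continuous_plateau : continuous (plateau l d).
Proof.
move=> x.
have ct : 2 - (l - y) ^+ 2 / d ^+ 2 @[y --> x] --> 2 - (l - x) ^+ 2 / d ^+ 2.
  exact: cvgB (cvg_cst _) (cvgM (@cvg_lB2 x) (cvg_cst _)).
exact: continuous_min (cvg_cst _) (continuous_max (cvg_cst _) ct).
Qed.

Lemma quot_far x : d <= `|x - l| -> (x - l) * quot l d x = -1.
Proof.
move=> dx; have x0 : l - x != 0.
  by rewrite -normr_gt0 distrC (lt_le_trans d0).
rewrite /quot max_r; last first.
  by rewrite -[leRHS]real_normK ?num_real// distrC ler_sqr// ?nnegrE ltW.
by field.
Qed.

Lemma bump_far x : d <= `|x - l| -> bump l d x = 0.
Proof. by move=> /quot_far; rewrite /bump; nra. Qed.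

Lemma plateau_near x : `|x - l| < d -> plateau l d x = 1.
Proof.
move=> xd; have : (l - x) ^+ 2 / d ^+ 2 <= 1.
  rewrite ler_pdivrMr ?exprn_gt0// mul1r -[leLHS]real_normK ?num_real//.
  by rewrite distrC ler_sqr ?nnegrE// ltW.
by rewrite /plateau => ?; rewrite min_l// le_max; apply/orP; right; lra.
Qed.

Lemma plateau_far x : 2 * d <= `|x - l| -> plateau l d x = 0.
Proof.
move=> xd; have : 2 <= (l - x) ^+ 2 / d ^+ 2.
  rewrite ler_pdivlMr ?exprn_gt0// -[leRHS]real_normK ?num_real// distrC.
  apply: (@le_trans _ _ ((2 * d) ^+ 2)); first nra.
  by rewrite ler_sqr ?nnegrE// mulr_ge0// ltW.
by move=> ?; rewrite /plateau max_l ?min_r//; lra.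
Qed.

Lemma bump_plateau x : plateau l d x * bump l d x = bump l d x.
Proof.
have [xd|xd] := ltP `|x - l| d; first by rewrite plateau_near ?mul1r.
by rewrite bump_far ?mulr0.
Qed.

Lemma plateau_ge0 x : 0 <= plateau l d x.
Proof. by rewrite /plateau le_min ler01 le_max lexx. Qed.

Lemma plateau_le1 x : plateau l d x <= 1.
Proof. by rewrite /plateau ge_min lexx. Qed.

Lemma C0_quot : C0 (fun x => (quot l d x)%:C).
Proof.
apply: (@C0_decay _ l 1 d).
  exact/continuous_real_complex/continuous_quot.
move=> x /quot_far xd.
by rewrite normc_real -rmorphM lecR -normrM mulrC xd normrN1.
Qed.

Lemma C0_bump : C0 (fun x => (bump l d x)%:C).
Proof.
apply: (@C0_decay _ l 0 d).
  exact/continuous_real_complex/continuous_bump.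
by move=> x /bump_far ->; rewrite normr0 mul0r.
Qed.

Lemma C0_plateau : C0 (fun x => (plateau l d x)%:C).
Proof.
apply: (@C0_decay _ l 0 (2 * d)).
  exact/continuous_real_complex/continuous_plateau.
by move=> x /plateau_far ->; rewrite normr0 mul0r.
Qed.

End Cutoffs.
End ComplexC0.

(** * Cutoffs of an operator *)

Section BoundedOperators.
Variables (R : realType) (B : completeNormedModType R[i]).
Implicit Types (T : bounded_op B).

Lemma bounded_op_bound T :
  exists2 M : R, 0 < M & forall x, `|T x| <= M%:C * `|x|.
Proof.
have [M [Mreal TM]] := (linear_boundedP T).1 (bop_bounded T).
have [m m0 mE] : exists2 m : R, 0 < m & `|M| + 1 = m%:C.
  by apply: complex_gt0P; rewrite ltr_wpDl.
exists m => // x; rewrite -mE; apply: TM.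
by rewrite (le_lt_trans (real_ler_norm Mreal)) ?ltrDl.
Qed.

Lemma op_norm_bound T x : `|T x| <= (op_norm T)%:C * `|x|.
Proof.
have [->|x0] := eqVneq x 0; first by rewrite linear0 !normr0 mulr0.
have nx : `|x| != 0 by rewrite normr_eq0.
have [M M0 TM] := bounded_op_bound T.
set y := `|x|^-1 *: x.
have y1 : `|y| = 1 by rewrite normrZ normfV normr_id mulVf.
have -> : `|T x| = `|T y| * `|x|.
  by rewrite linearZ normrZ normfV normr_id mulrAC mulVf ?mul1r.
rewrite ler_wpM2r// -norm_RRe lecR; apply: ub_le_sup; last first.
  by exists y => //=; rewrite y1.
exists M => _ [z z1 <-]; rewrite -lecR norm_RRe (le_trans (TM z))//.
by rewrite ler_piMr// ler0c ltW.
Qed.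

Variable ip : {dot B for Num.conj}.
Variables (H : operator B) (phi : (R -> R[i]) -> bounded_op B).
Hypothesis phiH : functional_calculus ip H phi.

Lemma fcalcB f g : C0 f -> C0 g ->
  forall v, phi (fun x => f x - g x) v = phi f v - phi g v.
Proof.
move=> f0 g0 v; rewrite -scaleN1r -(fcalcZ phiH)// -(fcalcD phiH)//;
  last exact: C0Z.
by congr (phi _ v); apply/funext => x; rewrite mulN1r.
Qed.

(** When [bump(H) = 0], [quot_resolvent] becomes
    [Q = P (1 - (l - z) Q)] with [P = (z - H)^-1] and [Q = quot(H)].  So [Q]
    takes its values in the domain of [H], and applying [z - H] gives
    [(l - H) Q = 1]; that [Q] is also a left inverse uses that [P] and [Q]
    commute. *)
Lemma fcalc_quot_resolvent (l d : R) : 0 < d ->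
  (forall v, phi (fun x => (bump l d x)%:C) v = 0) ->
  is_resolvent H l%:C (phi (fun x => (quot l d x)%:C)).
Proof.
move=> d0 bump0; pose z : R[i] := 'i%C.
have z0 : complex.Im z != 0 by rewrite /= oner_eq0.
have [Rr Rl] := fcalc_resolvent phiH z0.
have Cg := C0_resolvent z0; have Cq := C0_quot l d0.
have Cb := C0_bump l d0.
set Q := phi _.
pose P := phi (resolvent_fun z).
have symb : (fun x => (quot l d x)%:C) = (fun x => (resolvent_fun z x -
    resolvent_fun z x * (bump l d x)%:C) -
    (l%:C - z) * (resolvent_fun z x * (quot l d x)%:C)).
  by apply/funext => x; exact: quot_resolvent.
have QE v : Q v = P v - (l%:C - z) *: P (Q v).
  rewrite {1}/Q [in LHS]symb fcalcB; last 2 first.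
  - by apply: C0D => //; under eq_fun do rewrite -mulN1r; apply: C0Z; exact: C0M.
  - by apply: C0Z; exact: C0M.
  rewrite fcalcB//; last exact: C0M.
  rewrite (fcalcZ phiH); last exact: C0M.
  by rewrite !(fcalcM phiH)// bump0 linear0 subr0.
have PQ v : P (Q v) = Q (P v).
  rewrite /P /Q -!(fcalcM phiH)//.
  by congr (phi _ v); apply/funext => x; rewrite mulrC.
have QP v : Q v = P (v - (l%:C - z) *: Q v).
  by rewrite linearB linearZ -QE.
split=> [y|x Hx].
- have [Py Pz] := Rr (y - (l%:C - z) *: Q y).
  rewrite -/P -QP in Py Pz; split=> //.
  rewrite -[l%:C](subrK z) scalerDl -addrA Pz.
  by rewrite addrC subrK.
- have := Rl x Hx; rewrite -/P => Px.
  have -> : l%:C *: x - H x = (z *: x - H x) + (l%:C - z) *: x.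
    by rewrite scalerBl [RHS]addrC addrA subrK.
  by rewrite linearD linearZ /= [Q (_ - _)]QE PQ Px subrK.
Qed.

(** On the range of [bump(H)] the operator [w - f(H)] agrees with
    [((w - f) * plateau)(H)], because [plateau * bump = bump].  Since [plateau]
    vanishes where [f] may be far from [w], the norm of that operator is at most
    [1 / (2 * M)]; a vector [u] of the range therefore satisfies
    [|u| <= M * |u| / (2 * M)]. *)
Lemma fcalc_bump0 (f : R -> R[i]) (w : R[i]) (S : bounded_op B) (M l d : R) :
  C0 f -> 0 < d -> 0 < M ->
  (forall v, S (w *: v - phi f v) = v) ->
  (forall v, `|S v| <= M%:C * `|v|) ->
  (forall x, `|x - l| < 2 * d -> `|w - f x| <= (2 * M)^-1%:C) ->
  forall v, phi (fun x => (bump l d x)%:C) v = 0.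
Proof.
move=> f0 d0 M0 SK SM fw v.
have Cb := C0_bump l d0; have Cp := C0_plateau l d0.
set u := phi _ v.
pose k x := w * (plateau l d x)%:C - f x * (plateau l d x)%:C.
have Ck : C0 k.
  rewrite /k; under eq_fun do rewrite -mulNr -mulN1r -mulrA.
  by apply: C0D; [exact: C0Z | apply: C0Z; exact: C0M].
have kle : sup_norm k <= (2 * M)^-1.
  have M20 : 0 <= (2 * M)^-1 by rewrite invr_ge0 mulr_ge0// ltW.
  apply: sup_norm_le => x; rewrite /k -mulrBl normrM normc_real.
  rewrite [`|plateau _ _ _|]ger0_norm ?plateau_ge0//.
  have [xd|xd] := ltP `|x - l| (2 * d); last first.
    by rewrite plateau_far// mulr0 ler0c.
  apply: le_trans (fw _ xd); rewrite ler_piMr//.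
  by rewrite -[1]/(1%:C) lecR plateau_le1.
have ku : w *: u - phi f u = phi k u.
  rewrite /u -(fcalcM phiH Ck Cb) -(fcalcM phiH f0 Cb) -(fcalcZ phiH _ Cb).
  rewrite -fcalcB; [|exact: C0Z|exact: C0M].
  congr (phi _ v); apply/funext => x.
  rewrite /k -{1 2}(bump_plateau l d0) rmorphM.
  by ring.
have : `|u| <= 2^-1 * `|u|.
  rewrite -{1}(SK u) ku (le_trans (SM _))//.
  apply: (@le_trans _ _ (M%:C * ((op_norm (phi k))%:C * `|u|))).
    by rewrite ler_wpM2l ?op_norm_bound// ler0c ltW.
  rewrite mulrA ler_wpM2r// -rmorphM.
  have -> : (2^-1 : R[i]) = (2^-1)%:C by rewrite fmorphV rmorph_nat.
  rewrite lecR (@le_trans _ _ (M * (2 * M)^-1))//.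
    by rewrite ler_pM2l// (le_trans (fcalc_norm phiH Ck)).
  by rewrite invfM mulrCA divff ?mulr1// gt_eqF.
rewrite -subr_le0 -{1}[`|u|]mul1r -mulrBl pmulr_rle0; last first.
  by rewrite subr_gt0 invf_lt1// ltr1n.
by rewrite normr_le0 => /eqP.
Qed.

End BoundedOperators.

Unset Implicit Arguments.
Set Strict Implicit.

Theorem lemma5p2 (R : realType) (B : completeNormedModType R[i])
    (ip : {dot B for Num.conj}) (H : operator B)
    (phi : (R -> R[i]) -> bounded_op B) (f : R -> R[i]) :
  induces_norm ip ->
  self_adjoint ip H ->
  functional_calculus ip H phi ->
  C0 f ->
  closure ([set f x | x in [set x : R | spectrum H x%:C]] : set R[i]^o)
    `<=` spectrum (op_of_bounded (phi f)).
Proof.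
move=> _ _ phiH f0 w clw [S [_ SK]].
have [M M0 SM] := bounded_op_bound S.
(* [fcalc_bump0] tolerates [1 / (2 * M)]: half is spent on the distance from
   [w] to [f l], half on the oscillation of [f] near [l]. *)
have e0 : 0 < ((4 * M)^-1)%:C :> R[i].
  by rewrite -[0]/(0%:C) ltcR invr_gt0 mulr_gt0.
have [_ [[l Hl <-]]] := clw _ (nbhsx_ballx (w : R[i]^o) _ e0).
rewrite -ball_normE /= => wl; apply: Hl.
have [fc _ _] := f0.
have fl := (@cvgrPdist_lt _ R[i]^o _ _ (nbhs_filter l) _ _).1 (fc l) _ e0.
have [r /= r0 fr] := (nbhs_ballP l _).1 fl.
have d0 : 0 < r / 2 by rewrite divr_gt0.
eexists; apply: (fcalc_quot_resolvent phiH d0).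
apply: (fcalc_bump0 phiH f0 d0 M0 _ SM) => [v|x].
  exact: SK.
rewrite mulrCA divff// mulr1 distrC => xr.
have -> : w - f x = (w - f l) + (f l - f x) by rewrite addrA subrK.
have -> : (2 * M)^-1%:C = (4 * M)^-1%:C + (4 * M)^-1%:C :> R[i].
  by rewrite -rmorphD; congr (_%:C); field; rewrite gt_eqF.
rewrite (le_trans (ler_normD _ _))// lerD// ltW//.
by apply: fr; rewrite -ball_normE.
Qed.
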